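(* Let $P$ be the probability measure on $\{1,2,3,4,5,6\}\subset\mathbb{R}$ with probability mass function $f(j)=\left(\frac{3}{10}\right)^{j-1}\frac{7}{10}$ for $j\in\{1,2,3,4,5\}$ and $f(6)=\left(\frac{3}{10}\right)^{5}$. The optimal set of two-means for $P$ is $\{1,a[2,6]\}$, with quantization error $V_2(P)=\frac{174296997}{1000000000}$.
   Context: For a Borel probability measure $P$ on $\mathbb{R}$ and a nonempty finite set $\alpha\subset\mathbb{R}$, the distortion error is $V(P;\alpha)=\int\min_{a\in\alpha}|x-a|^2\,dP(x)$. The $n$th quantization error is $V_n(P)=\inf\{V(P;\alpha):\alpha\subset\mathbb{R},\ 1\le\mathrm{card}(\alpha)\le n\}$, and a set $\alpha$ with $1\le\mathrm{card}(\alpha)\le n$ attaining this infimum is called an optimal set of $n$-means for $P$. For $i\le j$ in $\{1,\dots,6\}$, $a[i,j]=\dfrac{\sum_{k=i}^{j}k f(k)}{\sum_{k=i}^{j}f(k)}$. *)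

(* Defs.v *)
From HB Require Import structures.
From mathcomp Require Import all_boot all_order all_algebra.
From mathcomp Require Import finmap.
From mathcomp Require Import all_classical all_reals all_analysis.
From mathcomp Require Import lra.

Set Implicit Arguments.
Unset Strict Implicit.
Unset Printing Implicit Defensive.

Import Order.TTheory GRing.Theory Num.Theory.
Import numFieldNormedType.Exports.

Local Open Scope classical_set_scope.
Local Open Scope ring_scope.

Section quantization.
Context {R : realType}.
Implicit Types (P : probability (measurableTypeR R) R) (alpha : {fset R}).

(* The minimum is taken in \bar R, where +oo is neutral for min: for nonempty
   alpha this is the usual minimum, for alpha empty it is +oo. *)
Definition distortion P alpha : \bar R :=
  (\int[P]_x \big[Order.min/+oo]_(a <- alpha) (`|x - a| ^+ 2)%:E)%E.

Definition quantization_error P (n : nat) : \bar R :=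
  ereal_inf [set distortion P alpha
            | alpha in [set alpha : {fset R} | (1 <= #|` alpha| <= n)%N]].

Definition optimal_n_means P (n : nat) alpha : Prop :=
  (1 <= #|` alpha| <= n)%N /\ distortion P alpha = quantization_error P n.

End quantization.

Section truncated_geometric.
Context {R : realType}.

Definition trunc_geom_pmf (j : nat) : R :=
  if (1 <= j <= 5)%N then (3 / 10) ^+ (j - 1) * (7 / 10)
  else if j == 6%N then (3 / 10) ^+ 5
  else 0.

Lemma trunc_geom_pmf_ge0 j : 0 <= trunc_geom_pmf j.
Proof.
rewrite /trunc_geom_pmf; do 2 case: ifP => _ //.
all: by rewrite ?mulr_ge0 ?exprn_ge0 ?divr_ge0.
Qed.

Definition trunc_geom : set (measurableTypeR R) -> \bar R :=
  msum (fun k => mscale (NngNum (trunc_geom_pmf_ge0 k.+1))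
                        (@dirac _ (measurableTypeR R) k.+1%:R R)) 6.

HB.instance Definition _ := Measure.on trunc_geom.

Lemma trunc_geomE (A : set (measurableTypeR R)) :
  trunc_geom A = (\sum_(k < 6) (trunc_geom_pmf k.+1)%:E * \d_(k.+1%:R : R) A)%E.
Proof. by []. Qed.

Lemma trunc_geom_setT : trunc_geom setT = 1%E.
Proof.
rewrite trunc_geomE; under eq_bigr do rewrite diracT mule1.
rewrite sumEFin !big_ord_recl big_ord0 /trunc_geom_pmf /bump /=; congr (_%:E).
by rewrite !subSS !subn0; lra.
Qed.

HB.instance Definition _ :=
  @Measure_isProbability.Build _ _ R trunc_geom trunc_geom_setT.

Definition cond_mean (i j : nat) : R :=
  (\sum_(i <= k < j.+1) k%:R * trunc_geom_pmf k) /
  (\sum_(i <= k < j.+1) trunc_geom_pmf k).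

End truncated_geometric.

Arguments trunc_geom R : clear implicits.

(* Main.v *)
(** For [a <= b] the points nearer to [a] form an initial segment of 1..6.  If
    that segment is {1}, the distortion is the claimed value plus
    [7/10 (a - 1)^2 + 3/10 (b - a[2,6])^2].  Otherwise 1, 2, 3 share a center,
    or the clusters are {1,2} and {3,4,5,6}; in both cases the sum of squares
    about the cluster means is already strictly larger than the claimed value. *)
Require Import Defs.
From mathcomp Require Import all_boot all_order all_algebra.
From mathcomp Require Import finmap.
From mathcomp Require Import all_classical all_reals all_analysis.
From mathcomp Require Import measurable_realfun lra.

Import Order.TTheory GRing.Theory Num.Theory.

Local Open Scope ring_scope.

Section two_means.
Context {R : realType}.
Implicit Types a b x : R.

(** The points [a] and [b] may coincide, so one-point sets need no separate treatment later. *)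
Lemma cardfs_le2P (K : choiceType) (A : {fset K}) :
  (1 <= #|` A| <= 2)%N -> exists a b : K, A = [fset a; b]%fset.
Proof.
case/andP => A_gt0 A_le2.
have /fset0Pn[a aA] : A != fset0 by rewrite -cardfs_gt0.
have A_a : A = (a |` (A `\ a))%fset by rewrite fsetD1K.
have : (#|` (A `\ a)%fset| <= 1)%N by move: A_le2; rewrite (cardfsD1 a) aA.
rewrite leq_eqVlt ltnS leqn0 => /orP[/cardfs1P[b Ab]|].
  by exists a, b; rewrite A_a Ab.
rewrite cardfs_eq0 => /eqP A0.
by exists a, a; rewrite A_a A0 fsetU0 fsetUid.
Qed.

Definition sqdist2 a b x : R := Num.min ((x - a) ^+ 2) ((x - b) ^+ 2).

Lemma sqdist2C a b : sqdist2 a b = sqdist2 b a.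
Proof. by apply/funext => x; rewrite /sqdist2 minC. Qed.

Lemma sqdist2_ge0 a b x : 0 <= sqdist2 a b x.
Proof. by rewrite /sqdist2 le_min !sqr_ge0. Qed.

(** [(x - b)^2 - (x - a)^2 = (b - a) * (a + b - 2 * x)], so the midpoint decides which center is
    nearer. *)
Lemma sqdist2_left a b x : a <= b -> 2 * x <= a + b ->
  sqdist2 a b x = (x - a) ^+ 2.
Proof. by move=> ab xab; apply/min_idPl; nra. Qed.

Lemma sqdist2_right a b x : a <= b -> a + b <= 2 * x ->
  sqdist2 a b x = (x - b) ^+ 2.
Proof. by move=> ab xab; apply/min_idPr; nra. Qed.

Lemma measurable_sqdist2 a b :
  measurable_fun [set: measurableTypeR R] (sqdist2 a b).
Proof.
apply: measurable_minr; apply: measurable_funX; apply: measurable_funB.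
- exact: measurable_id.
- exact: measurable_cst.
- exact: measurable_id.
- exact: measurable_cst.
Qed.

Lemma big_min_fset2 a b x :
  \big[Order.min/+oo%E]_(c <- [fset a; b]%fset) (`|x - c| ^+ 2)%:E =
  (sqdist2 a b x)%:E.
Proof.
rewrite /sqdist2 -(real_normK (num_real (x - a))) -(real_normK (num_real (x - b))).
have [->|ab] := eqVneq a b; first by rewrite fsetUid big_seq_fset1 minxx.
by rewrite big_fsetU1 ?inE// big_seq_fset1 EFin_min.
Qed.

Definition two_means_cost a b : R :=
  \sum_(k < 6) trunc_geom_pmf k.+1 * sqdist2 a b k.+1%:R.

(** The measure is a finite sum of scaled Dirac masses, and the integrand is measurable and
    nonnegative, so the integral splits into its values at the atoms. *)
Lemma distortion_trunc_geom a b :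
  distortion (trunc_geom R) [fset a; b]%fset = (two_means_cost a b)%:E.
Proof.
rewrite /distortion.
under eq_integral do rewrite big_min_fset2.
have mf : measurable_fun [set: measurableTypeR R]
    (fun x : measurableTypeR R => (sqdist2 a b x)%:E).
  by apply/measurable_EFinP; exact: measurable_sqdist2.
have f0 x : [set: measurableTypeR R]%classic x -> (0 <= (sqdist2 a b x)%:E)%E.
  by move=> _; rewrite lee_fin sqdist2_ge0.
rewrite ge0_integral_measure_sum// -sumEFin; apply: eq_bigr => k _.
by rewrite ge0_integral_mscale// integral_dirac// diracT mul1e.
Qed.

Definition V2 : R := (174 * 10 ^+ 6 + 296 * 10 ^+ 3 + 997) / 10 ^+ 9.

Lemma cond_mean26 : cond_mean 2 6 = 2 + 425 / 10 ^+ 3 + 1 / 10 ^+ 4 :> R.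
Proof.
rewrite /cond_mean /index_iota /= !big_cons !big_nil /trunc_geom_pmf /=.
rewrite !subSS !subn0; apply: (canLR (mulfK _)); last by lra.
by apply: lt0r_neq0; lra.
Qed.

Lemma two_means_costE a b :
  two_means_cost a b =
    7 / 10 * sqdist2 a b 1 + 21 / 100 * sqdist2 a b 2 +
    63 / 10 ^+ 3 * sqdist2 a b 3 + 189 / 10 ^+ 4 * sqdist2 a b 4 +
    567 / 10 ^+ 5 * sqdist2 a b 5 + 243 / 10 ^+ 5 * sqdist2 a b 6.
Proof.
rewrite /two_means_cost !big_ord_recl big_ord0 /trunc_geom_pmf /bump /=.
rewrite !subSS !subn0; lra.
Qed.

(** The exact excess on one side and the strict inequality on the other give both minimality and
    uniqueness. *)
Lemma two_means_cost_cases a b : a <= b ->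
  two_means_cost a b =
    V2 + 7 / 10 * (a - 1) ^+ 2 + 3 / 10 * (b - cond_mean 2 6) ^+ 2
  \/ V2 < two_means_cost a b.
Proof.
move=> ab; rewrite cond_mean26 two_means_costE /V2.
have near_a x : 2 * x <= a + b -> sqdist2 a b x = (x - a) ^+ 2.
  exact: sqdist2_left.
have near_b x : a + b <= 2 * x -> sqdist2 a b x = (x - b) ^+ 2.
  exact: sqdist2_right.
(* When 1, 2, 3 share a center, their terms alone exceed [V2]; for 4, 5, 6 nonnegativity
   suffices. *)
have q4 := sqdist2_ge0 a b 4.
have q5 := sqdist2_ge0 a b 5.
have q6 := sqdist2_ge0 a b 6.
(* 187/139, 112/91 and 3417/1000 are the means of {1,2,3}, {1,2} and {3,..,6}. *)
have [s1|s1] := leP (a + b) 2.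
  right; rewrite (near_b 1) ?(near_b 2) ?(near_b 3); try lra.
  have := sqr_ge0 (139 * b - 187); lra.
have [s3|s3] := leP 6 (a + b).
  right; rewrite (near_a 1) ?(near_a 2) ?(near_a 3); try lra.
  have := sqr_ge0 (139 * a - 187); lra.
(* The midpoint now lies strictly between 1 and 3, so only the point 2 is undecided. *)
rewrite (near_a 1) ?(near_b 3) ?(near_b 4) ?(near_b 5) ?(near_b 6); try lra.
have [s2|s2] := leP 4 (a + b).
  right; rewrite (near_a 2); last lra.
  have := sqr_ge0 (91 * a - 112); have := sqr_ge0 (1000 * b - 3417); lra.
(* The clusters {1} and {2,...,6} have masses 7/10 and 3/10, and [V2] is the weighted sum of squares
   of the second about its mean. *)
left; rewrite (near_b 2); lra.
Qed.

(** The midpoint of 1 and 2.4251 lies between 1 and 2, so these centers do produce the clusters {1}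
    and {2,...,6}. *)
Lemma two_means_cost_opt : two_means_cost 1 (cond_mean 2 6) = V2.
Proof.
rewrite two_means_costE cond_mean26 /V2.
by rewrite (sqdist2_left _ _ 1) ?(sqdist2_right _ _ 2)
  ?(sqdist2_right _ _ 3) ?(sqdist2_right _ _ 4) ?(sqdist2_right _ _ 5)
  ?(sqdist2_right _ _ 6); lra.
Qed.

Lemma two_means_costC a b : two_means_cost a b = two_means_cost b a.
Proof. by rewrite /two_means_cost sqdist2C. Qed.

Lemma two_means_cost_ge a b : V2 <= two_means_cost a b.
Proof.
wlog ab : a b / a <= b => [thm|].
  by have [/thm//|/ltW/thm] := leP a b; rewrite two_means_costC.
have [->|/ltW//] := two_means_cost_cases a b ab.
by rewrite -addrA lerDl addr_ge0// mulr_ge0 ?sqr_ge0//; lra.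
Qed.

Lemma two_means_cost_eq a b : two_means_cost a b = V2 ->
  [fset a; b]%fset = [fset 1; cond_mean 2 6]%fset.
Proof.
wlog ab : a b / a <= b => [thm|].
  by have [/thm//|/ltW/thm] := leP a b; rewrite two_means_costC fsetUC.
move=> cost; have := two_means_cost_cases a b ab.
rewrite cost ltxx => -[eqV|//].
have a1_ge0 := sqr_ge0 (a - 1); have bm_ge0 := sqr_ge0 (b - cond_mean 2 6).
(* Two nonnegative squares with positive weights sum to zero, so each vanishes. *)
have /eqP : (a - 1) ^+ 2 = 0 by lra.
have /eqP : (b - cond_mean 2 6) ^+ 2 = 0 by lra.
by rewrite !sqrf_eq0 !subr_eq0 => /eqP -> /eqP ->.
Qed.

End two_means.

Theorem proposition3p7 (R : realType) :
  (forall alpha : {fset R},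
     optimal_n_means (trunc_geom R) 2 alpha <->
     alpha = [fset 1; cond_mean 2 6]%fset) /\
  (* 174296997 / 1000000000, in base 1000: a numeral in ring_scope is a unary nat *)
  quantization_error (trunc_geom R) 2 = ((174 * 10 ^+ 6 + 296 * 10 ^+ 3 + 997) / 10 ^+ 9)%:E.
Proof.
have card2 (a b : R) : (1 <= #|` [fset a; b]%fset| <= 2)%N.
  by rewrite cardfs2; case: (a != b).
have qe : quantization_error (trunc_geom R) 2 = V2%:E.
  apply/eqP; rewrite eq_le; apply/andP; split.
    apply: ereal_inf_lbound; exists [fset 1; cond_mean 2 6]%fset; first exact: card2.
    by rewrite distortion_trunc_geom two_means_cost_opt.
  apply: le_ereal_inf_tmp => _ [_ /cardfs_le2P[a [b ->]] <-].
  by rewrite distortion_trunc_geom lee_fin two_means_cost_ge.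
split=> // alpha; rewrite /optimal_n_means qe; split=> [[]|->].
  move=> /cardfs_le2P[a [b ->]]; rewrite distortion_trunc_geom => -[].
  exact: two_means_cost_eq.
by split; [exact: card2 | rewrite distortion_trunc_geom two_means_cost_opt].
Qed.
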